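(* Let $T=(T_t)_{t\ge 0}$ be a subordinator with Laplace exponent $\phi$, i.e. $\mathbb{E}e^{-\lambda T_t}=e^{-t\phi(\lambda)}$ for $\lambda>0$, and set $H(\lambda)=\phi(\lambda)-\lambda\phi'(\lambda)$ for $\lambda>0$. If $H$ varies regularly at $0$ (at $\infty$, respectively) with index $\gamma\in[0,2)$, then \[ \mathbb{P}(T_t\ge r)\sim \frac{1}{\Gamma(2-\gamma)}\, t\,H(r^{-1}),\qquad r\to\infty\ (r\to 0,\text{ resp.})\ \text{ and }\ t\frac{\phi(r^{-1})^2}{H(r^{-1})}\to 0 . \]
   Context: A subordinator is a non-decreasing Lévy process; its Laplace exponent $\phi:(0,\infty)\to(0,\infty)$ has the form $\phi(\lambda)=b\lambda+\int_{(0,\infty)}(1-e^{-\lambda s})\mu(ds)$ with $b\ge0$ and $\int(1\wedge s)\mu(ds)<\infty$. A function $\ell:(0,\infty)\to(0,\infty)$ varies regularly at $\infty$ (at $0$) with index $\alpha$ if $\ell(\lambda s)/\ell(s)\to\lambda^\alpha$ as $s\to\infty$ ($s\to0$) for every $\lambda>0$. Notation: for functions $f,g,h$ of $(t,r)\in(0,\infty)^2$, ''$f(t,r)\sim g(t,r)$, $r\to a$ and $h(t,r)\to 0$'' means $\lim f(t,r)/g(t,r)=1$ where the limit is taken jointly as $r\to a$ and $h(t,r)\to0$ (i.e. for every $\varepsilon>0$ there is a neighbourhood $U$ of $a$ and $\delta>0$ such that $|f/g-1|<\varepsilon$ whenever $r\in U$ and $h(t,r)<\delta$). *)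

(* Defs.v *)
From HB Require Import structures.
From mathcomp Require Import all_boot all_order all_algebra.
From mathcomp Require Import all_classical all_reals all_analysis.
Set Implicit Arguments. Unset Strict Implicit. Unset Printing Implicit Defensive.
Import Order.TTheory GRing.Theory Num.Theory.
Import numFieldNormedType.Exports.
Local Open Scope classical_set_scope.
Local Open Scope ring_scope.

Definition Gamma (R : realType) (x : R) : R :=
  Rintegral (@lebesgue_measure R) `]0, +oo[%classic
    (fun s => powR s (x - 1) * expR (- s)).

Definition regvar_infty (R : realType) (l : R -> R) (a : R) : Prop :=
  (forall s, 0 < s -> 0 < l s) /\
  forall lam, 0 < lam -> (fun s => l (lam * s) / l s) @ +oo --> powR lam a.

Definition regvar_zero (R : realType) (l : R -> R) (a : R) : Prop :=
  (forall s, 0 < s -> 0 < l s) /\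
  forall lam, 0 < lam -> (fun s => l (lam * s) / l s) @ 0^'+ --> powR lam a.

Definition asymp_infty (R : realType) (f g h : R -> R -> R) : Prop :=
  forall eps, 0 < eps -> exists M delta, 0 < delta /\
    forall t r, 0 < t -> 0 < r -> M < r -> `|h t r| < delta ->
      `|f t r / g t r - 1| < eps.

Definition asymp_zero (R : realType) (f g h : R -> R -> R) : Prop :=
  forall eps, 0 < eps -> exists eta delta, 0 < eta /\ 0 < delta /\
    forall t r, 0 < t -> 0 < r -> r < eta -> `|h t r| < delta ->
      `|f t r / g t r - 1| < eps.

Definition subordinator (R : realType) (d : measure_display)
    (Omega : measurableType d) (P : probability Omega R)
    (T : R -> Omega -> R) : Prop :=
  (forall t, 0 <= t -> measurable_fun setT (T t)) /\
      (forall w, T 0 w = 0) /\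
      (forall w s t, 0 <= s -> s <= t -> T s w <= T t w) /\
      (forall w t, 0 <= t -> (fun u => T u w) @ t^'+ --> T t w) /\
      (forall s t (B : set R), 0 <= s -> 0 <= t -> measurable B ->
         P [set w | T (s + t) w - T s w \in B] = P [set w | T t w \in B]) /\
      (forall (n : nat) (ts : nat -> R) (B : nat -> set R),
         0 <= ts 0%N -> (forall i, ts i <= ts i.+1) ->
         (forall i, measurable (B i)) ->
         P (\bigcap_(i in [set k | (k < n)%N])
               [set w | T (ts i.+1) w - T (ts i) w \in B i]) =
         (\prod_(i < n) P [set w | (T (ts i.+1) w - T (ts i) w)%R \in B i])%E).

Definition laplace_exponent (R : realType) (d : measure_display)
    (Omega : measurableType d) (P : probability Omega R)
    (T : R -> Omega -> R) (phi : R -> R) : Prop :=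
  forall t lam, 0 <= t -> 0 < lam ->
    (\int[P]_w (expR (- lam * T t w))%:E = (expR (- t * phi lam))%:E)%E.

(* Main.v *)
Require Import Defs.
From HB Require Import structures.
From mathcomp Require Import all_boot all_order all_algebra.
From mathcomp Require Import all_classical all_reals all_analysis.
From mathcomp Require Import measurable_realfun ring lra.
Set Implicit Arguments.
Unset Strict Implicit.
Unset Printing Implicit Defensive.
Import Order.TTheory GRing.Theory Num.Theory.
Import numFieldNormedType.Exports.
Local Open Scope classical_set_scope.
Local Open Scope ring_scope.

(** Put [X = T_t / r] and [N = t H(1/r)]. Integrating [s e^{-ks}] against the
    tail of [X] amounts to taking the expectation of [linexp_prim k X], where
    [linexp_prim k x] is the integral of [s e^{-ks}] over [0 <= s <= x]. By the
    Laplace transform of [T_t] and its derivative,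
    [k^2 E (linexp_prim k X) = 1 - e^{-x} - y e^{-x}] with [x = t phi(k/r)] and
    [y = t (k/r) phi'(k/r)]; this is [x - y = t H(k/r)] up to [x^2], and
    [x^2 / N] is at most [k^2 t phi(1/r)^2 / H(1/r)]. Hence
    [E (linexp_prim k X) / N] is close to [k^(gamma - 2)] for each [k >= 1].

    The tail is recovered by Karamata's Tauberian method. A bump in
    [y = e^{-s}] supported on [alpha <= s <= beta] is squeezed between
    polynomials in [y], which correspond to linear combinations of the
    [linexp_prim k]; their primitives minorize ([alpha = 1]) or majorize
    ([beta = 1]) a multiple of the indicator of [1 <= X]. The limit of these
    combinations is an integral against [s^(1 - gamma) / Gamma(2 - gamma)], and
    letting the interval shrink to [1] gives [1 / Gamma(2 - gamma)]. *)

(** * Polynomial approximation *)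

(** The expectation of [g] at the number of successes among [n] Bernoulli trials of parameter [x].
    The recursion conditions on one trial, a success shifting [g], so that no binomial coefficient
    appears. *)
Fixpoint bernstein (R : realType) (n : nat) (g : nat -> R) : {poly R} :=
  if n is m.+1 then
    'X * bernstein m (fun k => g k.+1) + (1 - 'X) * bernstein m g
  else (g 0%N)%:P.

Lemma le_bernstein (R : realType) (n : nat) (g h : nat -> R) (x : R) :
  0 <= x -> x <= 1 -> (forall k, (k <= n)%N -> g k <= h k) ->
  (bernstein n g).[x] <= (bernstein n h).[x].
Proof.
move=> x0 x1; elim: n g h => [|n IHn] g h gh /=.
  by rewrite !hornerC gh.
rewrite !hornerE lerD// ler_wpM2l ?subr_ge0//; apply: IHn => k kn.
- exact: gh.
- by apply: gh; rewrite leqW.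
Qed.

(* For [n] Bernoulli([x]) trials with sum [k], this is
   [E (a + b * (k - c)^2)], whose variance part is [n * x * (1 - x)]. *)
Lemma bernstein_quadratic (R : realType) (n : nat) (a b c x : R) :
  (bernstein n (fun k => a + b * (k%:R - c) ^+ 2)).[x] =
  a + b * (n%:R * x * (1 - x) + (n%:R * x - c) ^+ 2).
Proof.
elim: n c => [|n IHn] c /=; first by rewrite !hornerE /=; ring.
under [fun k => _]funext => k.
  rewrite (_ : k.+1%:R - c = k%:R - (c - 1)); last by rewrite -natr1; ring.
  over.
by rewrite !hornerE /= !IHn -natr1; ring.
Qed.

(** Bernstein's proof: the error at [x] is at most the expectation of [|h (k / n) - h x|], and a
    quadratic in [k] with explicit expectation dominates this quantity. *)
Lemma lipschitz_poly_approx (R : realType) (h : R -> R) (L eta : R) :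
  0 < eta ->
  (forall y z, 0 <= y <= 1 -> 0 <= z <= 1 -> `|h y - h z| <= L * `|y - z|) ->
  exists p : {poly R}, forall x, 0 <= x <= 1 -> `|p.[x] - h x| <= eta.
Proof.
move=> eta0 hL.
(* The variance will contribute [L^2 * x * (1 - x) / (2 * eta * n)], which this [n] brings below
   [eta / 2]. *)
pose n := (Num.truncn (L ^+ 2 / eta ^+ 2)).+1.
have n0 : 0 < n%:R :> R by rewrite ltr0n.
have nL : L ^+ 2 / eta ^+ 2 <= n%:R by apply/ltW/truncnS_gt.
exists (bernstein n (fun k => h (k%:R / n%:R))) => x x01.
have /andP[x0 x1] := x01.
pose b := L ^+ 2 / (eta *+ 2 * n%:R ^+ 2).
have b0 : 0 <= b.
  by rewrite /b divr_ge0 ?sqr_ge0// mulr_ge0 ?sqr_ge0// mulrn_wge0 ?ltW.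
(* AM-GM: [L * D <= eta / 2 + L^2 * D^2 / (2 * eta)] *)
have key k : (k <= n)%N ->
    `|h (k%:R / n%:R) - h x| <= eta / 2 + b * (k%:R - n%:R * x) ^+ 2.
  move=> kn; apply: le_trans (hL _ _ _ x01) _.
    by rewrite divr_ge0//= ler_pdivrMr// mul1r ler_nat.
  set D := `|_|.
  have -> : b * (k%:R - n%:R * x) ^+ 2 = L ^+ 2 * D ^+ 2 / (eta *+ 2).
    rewrite /D /b real_normK ?num_real//; field.
    by rewrite !gt_eqF.
  rewrite -subr_ge0 (_ : _ - _ = (eta - L * D) ^+ 2 / (eta *+ 2)).
    by rewrite divr_ge0 ?sqr_ge0 ?mulrn_wge0 ?ltW.
  by field; rewrite gt_eqF.
have bnd : b * (n%:R * x * (1 - x) + (n%:R * x - n%:R * x) ^+ 2) <= eta / 2.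
  rewrite subrr expr0n addr0 /=.
  rewrite (_ : b * _ = (L ^+ 2 / eta ^+ 2) * (x * (1 - x)) *
      (eta / (2 * n%:R))); last first.
    by rewrite /b; field; rewrite !gt_eqF.
  apply: (@le_trans _ _ (n%:R * 1 * (eta / (2 * n%:R)))); last first.
    by rewrite le_eqVlt; apply/orP; left; apply/eqP; field; rewrite gt_eqF.
  rewrite ler_wpM2r ?divr_ge0 ?(ltW eta0) ?mulr_ge0 ?(ltW n0)//.
  apply: ler_pM => //; first by rewrite divr_ge0 ?sqr_ge0.
    by rewrite mulr_ge0 ?subr_ge0.
  by rewrite -[leRHS]mul1r ler_pM ?subr_ge0 ?gerBl.
rewrite ler_distl; apply/andP; split.
  apply: le_trans (@le_bernstein _ n
    (fun k => h x - eta / 2 + - b * (k%:R - n%:R * x) ^+ 2) _ _ x0 x1 _).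
    by rewrite bernstein_quadratic; lra.
  move=> k /key; rewrite ler_norml => /andP[? _]; lra.
apply: le_trans (@le_bernstein _ n _
  (fun k => h x + eta / 2 + b * (k%:R - n%:R * x) ^+ 2) _ x0 x1 _) _.
  move=> k /key; rewrite ler_norml => /andP[_ ?]; lra.
by rewrite bernstein_quadratic; lra.
Qed.

(** * Gamma densities *)

(** Monotone convergence. The scale [c] is left free because multiplication by [k] carries the
    intervals for [c = 1] onto those for [c = k]. *)
Lemma ge0_integral_itv_exhaustion (R : realType) (f : R -> R) (c : R) :
  0 < c -> measurable_fun (`]0, +oo[ : set R) f ->
  (forall x, 0 < x -> 0 <= f x) ->
  (\int[lebesgue_measure]_(x in `[(c / n.+1%:R)%R, (c * n.+1%:R)%R])
      (f x)%:E)%E @[n --> \oo] -->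
  (\int[lebesgue_measure]_(x in `]0%R, +oo[) (f x)%:E)%E.
Proof.
move=> c0 mf f0.
pose A n : set R := `[c / n.+1%:R, c * n.+1%:R]%classic.
have A0 n x : A n x -> 0 < x.
  rewrite /A /= in_itv/= => /andP[+ _]; apply: lt_le_trans.
  by rewrite divr_gt0.
have -> : `]0, +oo[%classic = \bigcup_n A n.
  apply/seteqP; split => x /=; last first.
    by move=> [n _ /A0 x0]; rewrite in_itv/= x0.
  rewrite in_itv/= andbT => x0.
  exists (maxn (Num.truncn (c / x)) (Num.truncn (x / c))) => //.
  have h (y : R) m : (Num.truncn y <= m)%N -> y <= m.+1%:R.
    move=> ym; apply: (le_trans (ltW (truncnS_gt y))).
    by rewrite ler_nat ltnS.
  rewrite /A /= in_itv/=; apply/andP; split.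
    by rewrite ler_pdivrMr// mulrC -ler_pdivrMr// h// leq_maxl.
  by rewrite mulrC -ler_pdivrMr// h// leq_maxr.
apply: ge0_nondecreasing_set_cvg_integral.
- apply/nondecreasing_seqP => n; rewrite subsetEset => x.
  rewrite /A /= !in_itv/= => /andP[ax xb]; apply/andP; split.
    apply: le_trans ax; rewrite ler_pM2l// lef_pV2 ?posrE//.
    by rewrite ler_nat.
  by apply: le_trans xb _; rewrite ler_pM2l// ler_nat.
- by move=> n; exact: measurable_itv.
- move=> n; apply/measurable_EFinP; apply: measurable_funS mf => //.
  by move=> x /A0 x0; rewrite /= in_itv/= x0.
- by move=> n x /A0 /f0; rewrite lee_fin.
Qed.

(** Shape [a] and rate [k], without normalisation: for positive [a] and [k] the total mass is
    [k^(-a) * Gamma a]. *)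
Definition gamma_density (R : realType) (a k s : R) : R :=
  s `^ (a - 1) * expR (- (k * s)).

Lemma gamma_density_ge0 (R : realType) (a k s : R) : 0 <= gamma_density a k s.
Proof. by rewrite mulr_ge0 ?powR_ge0 ?expR_ge0. Qed.

Lemma measurable_gamma_density (R : realType) (a k : R) (D : set R) :
  measurable_fun D (gamma_density a k).
Proof.
apply: measurable_funTS; apply: measurable_funM; first exact: measurable_powR.
by apply: measurableT_comp => //; apply: measurableT_comp => //.
Qed.

Lemma continuous_gamma_density (R : realType) (a k s : R) : 0 < s ->
  {for s, continuous (gamma_density a k)}.
Proof.
move=> s0.
have c1 : {for s, continuous (fun s => s `^ (a - 1))}.
  apply: differentiable_continuous; apply/derivable1_diffP.
  by apply: derivable_powR; rewrite in_itv/= s0.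
have c2 : {for s, continuous (fun s => expR (- (k * s)))}.
  apply: continuous_comp; last exact: continuous_expR.
  by apply: cvgN; apply: cvgM; [exact: cvg_cst|exact: cvg_id].
exact: cvgM c1 c2.
Qed.

(** The substitution [s = k * u], made on compact intervals and passed to the limit. Being an
    identity of extended reals, it also transfers finiteness from rate [1] to rate [k]. *)
Lemma gamma_density_scale (R : realType) (a k : R) : 0 < k ->
  (\int[lebesgue_measure]_(s in `]0%R, +oo[) (gamma_density a 1 s)%:E =
   (k `^ a)%:E *
   \int[lebesgue_measure]_(s in `]0%R, +oo[) (gamma_density a k s)%:E)%E.
Proof.
move=> k0.
transitivity (\int[lebesgue_measure]_(s in `]0%R, +oo[)
    (k `^ a * gamma_density a k s)%:E)%E; last first.
  under eq_integral do rewrite EFinM.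
  rewrite ge0_integralZl//=.
  - by apply/measurable_EFinP; exact: measurable_gamma_density.
  - by move=> s _; rewrite lee_fin gamma_density_ge0.
  - by rewrite lee_fin powR_ge0.
have c1 := ge0_integral_itv_exhaustion k0
  (@measurable_gamma_density R a 1 _) (fun x _ => gamma_density_ge0 a 1 x).
have c2 := ge0_integral_itv_exhaustion (@ltr01 R)
  (measurable_funM (measurable_cst (k `^ a)) (@measurable_gamma_density R a k _))
  (fun x _ => mulr_ge0 (powR_ge0 k a) (gamma_density_ge0 a k x)).
suff E n : (\int[lebesgue_measure]_(s in `[(k / n.+1%:R)%R, (k * n.+1%:R)%R])
      (gamma_density a 1 s)%:E =
    \int[lebesgue_measure]_(s in `[(1 / n.+1%:R)%R, (1 * n.+1%:R)%R])
      (k `^ a * gamma_density a k s)%:E)%E.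
  move: c1; under eq_cvg do rewrite E; move=> c1.
  exact: (cvg_unique (@ereal_hausdorff R) c1 c2).
have n0 : 0 < n.+1%:R :> R by rewrite ltr0n.
have p0 : 0 < n.+1%:R^-1 :> R by rewrite invr_gt0.
have pn : n.+1%:R^-1 <= n.+1%:R :> R.
  by rewrite -[leLHS]mul1r ler_pdivrMr// -natrM ler1n.
have dk (x : R) : is_derive x 1 ( *%R k) k.
  have := is_deriveM (is_derive_cst k x 1) (is_derive_id x 1).
  by rewrite scaler0 addr0 /GRing.scale /= mulr1.
rewrite !mul1r; symmetry.
have dE : derive1 ( *%R k) = cst k.
  by apply/funext => x; rewrite derive1E; apply: derive_val.
have ck x : {for x, continuous ( *%R k)}.
  by apply: cvgM; [exact: cvg_cst|exact: cvg_id].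
rewrite integration_by_substitution_increasing//.
- apply: eq_integral => x; rewrite inE/= in_itv/= => /andP[x1 x2].
  have x0 : 0 < x by exact: lt_le_trans x1.
  rewrite dE fctE /= /gamma_density mul1r powRM ?(ltW k0) ?(ltW x0)//.
  have -> : k `^ a = k `^ (a - 1) * k.
    rewrite powRD; last by rewrite (lt0r_neq0 k0) implybT.
    by rewrite powR_inv1 ?(ltW k0)// divfK// gt_eqF.
  congr EFin; ring.
- by move=> x y _ _ xy; rewrite ltr_pM2l.
- by move=> x _; rewrite dE; exact: cst_continuous.
- by rewrite dE; apply: is_cvg_cst.
- by rewrite dE; apply: is_cvg_cst.
- split.
  + by move=> x _; apply: ex_derive.
  + by apply: cvg_at_right_filter; exact: ck.
  + by apply: cvg_at_left_filter; exact: ck.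
- apply: continuous_in_subspaceT => x; rewrite inE/= in_itv/= => /andP[x1 _].
  apply: continuous_gamma_density; apply: lt_le_trans x1.
  by rewrite mulr_gt0.
Qed.

Lemma gamma_density_integral_lty (R : realType) (a : R) : 0 < a ->
  (\int[lebesgue_measure]_(s in `]0%R, +oo[) (gamma_density a 1 s)%:E < +oo)%E.
Proof.
move=> a0.
(* The density is dominated by a multiple of the derivative of the bounded
   function [(s / (1 + s)) ^ a], that is, of [s^(a - 1) / (1 + s)^(a + 1)]. *)
pose F (b s : R) := (s / (1 + s)) `^ b.
pose C := (a + 1) `^ (a + 1) / a.
have C0 : 0 <= C by rewrite divr_ge0 ?powR_ge0 ?ltW.
pose f (s : R) := a * F (a - 1) s * (1 + s) ^- 2.
have dV (s : R) : 0 < s ->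
    is_derive s 1 (fun s : R => (1 + s)^-1) (- (1 + s) ^- 2).
  move=> s0; have s1 : 0 < 1 + s by rewrite addr_gt0.
  rewrite -[X in is_derive _ _ _ X]mulr1 -[X in _ * X]add0r.
  by apply: is_deriveV; rewrite ?gt_eqF.
have dF (b s : R) : 0 < s ->
    is_derive s 1 (F b) (b * F (b - 1) s * (1 + s) ^- 2).
  move=> s0; have s1 : 0 < 1 + s by rewrite addr_gt0.
  rewrite (_ : F b = (fun y : R => y `^ b) \o (fun s : R => s / (1 + s)))//.
  apply: is_derive1_comp.
    by apply: is_derive1_powR; rewrite divr_gt0.
  have d1 := dV s s0.
  apply: is_derive_eq; rewrite /GRing.scale/=; field.
  by rewrite gt_eqF.
have dom (s : R) : 0 < s -> gamma_density a 1 s <= C * f s.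
  move=> s0; have s1 : 0 < 1 + s by rewrite addr_gt0.
  have a1 : 0 < a + 1 by rewrite addr_gt0.
  (* The inequality [1 + s / (a + 1) <= expR (s / (a + 1))] is raised to the power [a + 1]; this
     produces the constant [C]. *)
  have key : (1 + s) `^ (a + 1) <= (a + 1) `^ (a + 1) * expR s.
    have -> : expR s = expR (s / (a + 1)) `^ (a + 1).
      by rewrite -expRM divfK// gt_eqF.
    rewrite -powRM ?(ltW a1) ?expR_ge0//.
    rewrite ge0_ler_powR ?nnegrE ?(ltW a1) ?(ltW s1)//.
      by rewrite mulr_ge0 ?(ltW a1) ?expR_ge0.
    apply: (@le_trans _ _ ((a + 1) * (1 + s / (a + 1)))).
      rewrite mulrDr mulr1 mulrCA divff ?gt_eqF// mulr1 lerD2r; lra.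
    by rewrite ler_pM2l// expR_ge1Dx.
  rewrite /gamma_density mul1r expRN /f /F.
  have -> : (s / (1 + s)) `^ (a - 1) = s `^ (a - 1) / (1 + s) `^ (a - 1).
    rewrite powRM ?invr_ge0 ?(ltW s0) ?(ltW s1)//.
    by rewrite -[(1 + s)^-1]powR_inv1 ?(ltW s1)// powRAC powR_inv1 ?powR_ge0.
  have -> : C * (a * (s `^ (a - 1) / (1 + s) `^ (a - 1)) * (1 + s) ^- 2) =
      s `^ (a - 1) * ((a + 1) `^ (a + 1) / (1 + s) `^ (a + 1)).
    have -> : (1 + s) `^ (a + 1) = (1 + s) `^ (a - 1) * (1 + s) ^+ 2.
      rewrite -powR_mulrn ?ltW// -powRD; last by rewrite (gt_eqF s1) implybT.
      by congr powR; lra.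
    by rewrite /C; field; rewrite !gt_eqF ?powR_gt0.
  rewrite ler_wpM2l ?powR_ge0// ler_pdivlMr ?powR_gt0//.
  by rewrite mulrC ler_pdivrMr ?expR_gt0.
have c1 := ge0_integral_itv_exhaustion (@ltr01 R)
  (@measurable_gamma_density R a 1 _) (fun x _ => gamma_density_ge0 a 1 x).
(* The primitive [C * F a] of the dominating function takes values in [[0, C]], so [C] bounds every
   truncated integral. *)
apply: (@le_lt_trans _ _ C%:E); last exact: ltry.
apply: (@cvge_le _ _ _ _ _ _ _ _ c1).
apply: nearW => n; rewrite !mul1r.
have pn : n.+1%:R^-1 <= n.+1%:R :> R.
  by rewrite -[leLHS]mul1r ler_pdivrMr ?ltr0n// -natrM ler1n.
have cf (s : R) : 0 < s -> {for s, continuous (fun s => C * f s)}.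
  move=> s0; have h1 := dF (a - 1) s s0; have h2 := dV s s0.
  have cF : {for s, continuous (F (a - 1))}.
    apply: differentiable_continuous; apply/derivable1_diffP.
    exact: ex_derive.
  have cV : {for s, continuous (fun s : R => (1 + s)^-1)}.
    apply: differentiable_continuous; apply/derivable1_diffP.
    exact: ex_derive.
  have -> : (fun s => C * f s) =
      (fun s => C * a * F (a - 1) s * ((1 + s)^-1 * (1 + s)^-1)).
    by apply/funext => x; rewrite /f -exprVn expr2; ring.
  exact: cvgM (cvgM (cvg_cst _) cF) (cvgM cV cV).
(* Equality occurs when the interval is a single point; the fundamental theorem below needs distinct
   end points. *)
move: pn; rewrite le_eqVlt => /predU1P[->|pn].
  by rewrite set_itv1 integral_set1 lee_fin.
have cont_itv (g : R -> R) : (forall s : R, 0 < s -> {for s, continuous g}) ->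
    {within `[n.+1%:R^-1, n.+1%:R], continuous g}.
  move=> cg; apply: continuous_in_subspaceT => s; rewrite inE/= in_itv/=.
  by move=> /andP[s1 _]; apply: cg; apply: lt_le_trans s1.
apply: (@le_trans _ _ (\int[lebesgue_measure]_(s in `[n.+1%:R^-1%R, n.+1%:R%R])
    (C * f s)%:E)%E).
  apply: ge0_le_integral => //=.
  - by move=> s _; rewrite lee_fin gamma_density_ge0.
  - by apply/measurable_EFinP; exact: measurable_gamma_density.
  - apply/measurable_EFinP; apply: subspace_continuous_measurable_fun => //.
    exact: cont_itv.
  - move=> s; rewrite in_itv/= lee_fin => /andP[s1 _]; apply: dom.
    by apply: lt_le_trans s1; rewrite invr_gt0 ltr0n.
have dCF (s : R) : 0 < s -> is_derive s 1 (fun s => C * F a s) (C * f s).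
  by move=> s0; have h := dF a s s0; apply: is_derive_eq.
have cCF (s : R) : 0 < s -> {for s, continuous (fun s => C * F a s)}.
  move=> s0; have h := dCF s s0.
  apply: differentiable_continuous; apply/derivable1_diffP; exact: ex_derive.
have n0 : 0 < n.+1%:R^-1 :> R by rewrite invr_gt0 ltr0n.
rewrite (@continuous_FTC2 _ _ (fun s => C * F a s))//.
- rewrite -EFinB lee_fin -mulrBr -[leRHS]mulr1 ler_wpM2l//.
  rewrite (@le_trans _ _ (F a n.+1%:R)) ?gerBl ?powR_ge0//.
  apply: (@le_trans _ _ (1 `^ a)); last by rewrite powR1.
  rewrite ge0_ler_powR ?nnegrE ?(ltW a0)//.
  by rewrite ler_pdivrMr ?mul1r// lerDr.
- exact: cont_itv.
- split.
  + move=> s; rewrite in_itv/= => /andP[s1 _].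
    by have [] := dCF s (lt_trans n0 s1).
  + by apply: cvg_at_right_filter; apply: cCF.
  + by apply: cvg_at_left_filter; apply: cCF.
- move=> s; rewrite in_itv/= => /andP[s1 _].
  have h := dCF s (lt_trans n0 s1).
  by rewrite derive1E; apply: derive_val.
Qed.

Lemma integrable_gamma_density (R : realType) (a k : R) : 0 < a -> 0 < k ->
  lebesgue_measure.-integrable (`]0, +oo[ : set R)
    (EFin \o gamma_density a k).
Proof.
move=> a0 k0; apply/integrableP; split.
  by apply/measurable_EFinP; exact: measurable_gamma_density.
under eq_integral do rewrite /= ger0_norm ?gamma_density_ge0//.
have := gamma_density_integral_lty a0.
rewrite (gamma_density_scale a k0).
case: (integral _ _ _) => [r _| |_]; [exact: ltry| |by rewrite ltNye].
by rewrite mulry gtr0_sg ?powR_gt0// mul1e.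
Qed.

Lemma GammaE (R : realType) (a : R) :
  Gamma a = \int[lebesgue_measure]_(s in `]0, +oo[) gamma_density a 1 s.
Proof. by apply: eq_Rintegral => s _; rewrite /gamma_density mul1r. Qed.

Lemma Rintegral_gamma_density (R : realType) (a k : R) : 0 < a -> 0 < k ->
  \int[lebesgue_measure]_(s in `]0, +oo[) gamma_density a k s =
  k `^ (- a) * Gamma a.
Proof.
move=> a0 k0; rewrite GammaE {2}/Rintegral (gamma_density_scale a k0) fineM//.
  by rewrite /= mulrA powRN mulVf ?mul1r// gt_eqF ?powR_gt0.
exact: (integrable_fin_num _ (integrable_gamma_density a0 k0)).
Qed.

Lemma Rintegral_pos_gt0 (R : realType) (f : R -> R) (a b c : R) :
  lebesgue_measure.-integrable (`]0, +oo[ : set R) (EFin \o f) ->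
  (forall s, 0 < s -> 0 <= f s) -> 0 < a -> a < b -> 0 < c ->
  (forall s, a <= s <= b -> c <= f s) ->
  0 < \int[lebesgue_measure]_(s in `]0, +oo[) f s.
Proof.
move=> intf f0 a0 ab c0 cf.
have sub : `[a, b] `<=` (`]0, +oo[ : set R).
  by move=> s /=; rewrite !in_itv/= andbT => /andP[s1 _]; apply: lt_le_trans s1.
have intab : lebesgue_measure.-integrable (`[a, b] : set R) (EFin \o f).
  by apply: integrableS intf.
apply: (@lt_le_trans _ _ (\int[lebesgue_measure]_(s in `[a, b]) (cst c s))).
  have m : fine (lebesgue_measure (`[a, b]%classic : set R)) = b - a.
    by rewrite lebesgue_measure_itv/= lte_fin ab.
  rewrite Rintegral_cst//.
  by rewrite (_ : fine _ = b - a) ?mulr_gt0 ?subr_gt0//; exact: m.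
apply: (@le_trans _ _ (\int[lebesgue_measure]_(s in `[a, b]) f s)).
  apply: le_Rintegral => //.
  apply: continuous_compact_integrable; first exact: segment_compact.
  by apply: continuous_subspaceT => ?; exact: cvg_cst.
rewrite /Rintegral fine_le//.
- exact: integrable_fin_num.
- exact: integrable_fin_num.
apply: ge0_subset_integral => //.
  exact: (measurable_int _ intf).
by move=> s /=; rewrite in_itv/= andbT lee_fin => /f0.
Qed.

Lemma Gamma_gt0 (R : realType) (a : R) : 0 < a -> 0 < Gamma a.
Proof.
move=> a0; rewrite GammaE.
(* A lower bound of the density on [[1, 2]]; the minimum covers both signs of [a - 1]. *)
have c0 : 0 < Num.min 1 (2 `^ (a - 1)) * expR (- 2) :> R.
  by rewrite mulr_gt0 ?expR_gt0// lt_min ltr01 powR_gt0.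
apply: (Rintegral_pos_gt0 (integrable_gamma_density a0 ltr01)
  (fun s _ => gamma_density_ge0 a 1 s) (@ltr01 R) (@ltr1n R 2) c0).
move=> s /andP[s1 s2].
apply: ler_pM; rewrite ?expR_ge0 ?ler_expR ?le_min ?ler01 ?powR_ge0//; last first.
  by rewrite mul1r lerN2.
rewrite ge_min; have [a1|a1] := leP 1 a.
  by apply/orP; left; rewrite -[leLHS](powRr0 s) ler_powR//; lra.
apply/orP; right; rewrite -[a - 1]opprB !powRN lef_pV2 ?posrE ?powR_gt0//.
  by rewrite ge0_ler_powR// ?nnegrE ?subr_ge0 ?(ltW a1)//; lra.
by apply: lt_le_trans s1.
Qed.

(** * Primitives of [s e^{-ks}] *)

Definition linexp_prim (R : realType) (k x : R) : R :=
  (1 - (1 + k * x) * expR (- (k * x))) / k ^+ 2.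

(** The primitive vanishing at [0] of [s * e^(-s) * q(e^(-s))]. The factor [e^(-s)] in front is why
    the coefficient of degree [i] goes with the rate [i + 1]. *)
Definition linexp_prim_poly (R : realType) (q : {poly R}) (x : R) : R :=
  \sum_(i < size q) q`_i * linexp_prim i.+1%:R x.

Lemma is_derive_linexp_prim (R : realType) (k x : R) : 0 < k ->
  is_derive x 1 (linexp_prim k) (x * expR (- (k * x))).
Proof.
move=> k0.
have h1 : is_derive x 1 (fun x : R => - (k * x)) (- (k *: 1)).
  exact: is_deriveN (is_deriveZ k (is_derive_id x 1)).
have h2 := @is_derive1_comp _ (@expR R) (fun x => - (k * x)) x _ _
  (is_derive_expR _) h1.
have h3 := is_deriveD (is_derive_cst (1 : R) x 1) (is_deriveZ k (is_derive_id x 1)).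
have h4 := is_deriveB (is_derive_cst (1 : R) x 1) (is_deriveM h3 h2).
have := is_deriveM h4 (is_derive_cst (k ^- 2) x 1); congr is_derive.
rewrite scaler0 add0r.
change (k ^- 2 * (0 - ((1 + k * x) * (expR (- (k * x)) * - (k * 1)) +
  expR (- (k * x)) * (0 + k * 1))) = x * expR (- (k * x))).
by field; rewrite gt_eqF.
Qed.

Lemma linexp_prim0 (R : realType) (k : R) : linexp_prim k 0 = 0.
Proof. by rewrite /linexp_prim mulr0 oppr0 expR0 addr0 mulr1 subrr mul0r. Qed.

Lemma gamma_density_horner (R : realType) (a : R) (q : {poly R}) (s : R) :
  gamma_density a 1 s * q.[expR (- s)] =
  \sum_(i < size q) q`_i * gamma_density a i.+1%:R s.
Proof.
rewrite horner_coef mulr_sumr; apply: eq_bigr => i _.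
rewrite /gamma_density mul1r -expRM_natl.
have -> : - (i.+1%:R * s) = - s + i%:R * - s by rewrite -natr1; ring.
by rewrite expRD; ring.
Qed.

Lemma gamma_density21 (R : realType) (k s : R) : 0 <= s ->
  gamma_density 2 k s = s * expR (- (k * s)).
Proof.
by move=> s0; rewrite /gamma_density (_ : 2 - 1 = 1) ?powRr1//; lra.
Qed.

Lemma is_derive_linexp_prim_poly (R : realType) (q : {poly R}) (x : R) :
  is_derive x 1 (linexp_prim_poly q) (x * expR (- x) * q.[expR (- x)]).
Proof.
have -> : linexp_prim_poly q = \sum_(i < size q) (q`_i \*: linexp_prim i.+1%:R).
  by apply/funext => y; rewrite fct_sumE.
have h (i : 'I_(size q)) : is_derive x 1 (q`_i \*: linexp_prim i.+1%:R)
    (q`_i *: (x * expR (- (i.+1%:R * x)))).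
  by apply: is_deriveZ; apply: is_derive_linexp_prim; rewrite ltr0n.
have := is_derive_sum h; congr is_derive.
rewrite horner_coef mulr_sumr; apply: eq_bigr => i _.
rewrite -expRM_natl /GRing.scale/=.
have -> : - (i.+1%:R * x) = - x + i%:R * - x by rewrite -natr1; ring.
by rewrite expRD; ring.
Qed.

Lemma integrable_gamma_densityZ (R : realType) (a c k : R) : 0 < a -> 0 < k ->
  lebesgue_measure.-integrable (`]0, +oo[ : set R)
    (EFin \o (fun s => c * gamma_density a k s)).
Proof.
move=> a0 k0.
rewrite (_ : EFin \o _ = (fun s => c%:E * (gamma_density a k s)%:E)%E); last first.
  by apply/funext => s; rewrite /= EFinM.
exact: integrableZl (integrable_gamma_density a0 k0).
Qed.

Lemma integrable_gamma_density_poly (R : realType) (a : R) (q : {poly R}) :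
  0 < a -> lebesgue_measure.-integrable (`]0, +oo[ : set R)
    (EFin \o (fun s => gamma_density a 1 s * q.[expR (- s)])).
Proof.
move=> a0.
have -> : EFin \o (fun s : R => gamma_density a 1 s * q.[expR (- s)]) =
    (fun s => (\sum_(i < size q) (q`_i * gamma_density a i.+1%:R s)%:E)%E).
  by apply/funext => s; rewrite /= gamma_density_horner sumEFin.
apply: integrable_sum => // i _.
by apply: integrable_gamma_densityZ; rewrite ?ltr0n.
Qed.

Lemma Rintegral_gamma_density_poly (R : realType) (a : R) (q : {poly R}) :
  0 < a ->
  \int[lebesgue_measure]_(s in `]0, +oo[)
    (gamma_density a 1 s * q.[expR (- s)]) =
  Gamma a * \sum_(i < size q) q`_i * i.+1%:R `^ (- a).
Proof.
move=> a0; under eq_Rintegral do rewrite gamma_density_horner.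
have int i : lebesgue_measure.-integrable (`]0, +oo[ : set R)
    (EFin \o (fun s => q`_i * gamma_density a i.+1%:R s)).
  by apply: integrable_gamma_densityZ; rewrite ?ltr0n.
elim: (size q) => [|n IHn].
  under eq_Rintegral do rewrite big_ord0.
  by rewrite big_ord0 mulr0 Rintegral_cst// mul0r.
under eq_Rintegral do rewrite big_ord_recr/=.
rewrite RintegralD//; last first.
  rewrite (_ : EFin \o _ =
    (fun s => (\sum_(i < n) (q`_i * gamma_density a i.+1%:R s)%:E)%E)).
    by apply: integrable_sum => // i _; exact: int.
  by apply/funext => s; rewrite /= sumEFin.
rewrite IHn RintegralZl//; last by apply: integrable_gamma_density; rewrite ?ltr0n.
by rewrite Rintegral_gamma_density ?ltr0n// big_ord_recr/=; ring.
Qed.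

(** The fundamental theorem of calculus, as [gamma_density 2 1 s] is [s * e^(-s)] for [s >= 0]. In
    this form a comparison of integrands yields a comparison of primitives. *)
Lemma linexp_prim_polyE (R : realType) (q : {poly R}) (x : R) : 0 <= x ->
  linexp_prim_poly q x = \int[lebesgue_measure]_(s in `]0, x])
    (gamma_density 2 1 s * q.[expR (- s)]).
Proof.
have p0 : linexp_prim_poly q 0 = 0.
  by rewrite /linexp_prim_poly big1// => i _; rewrite linexp_prim0 mulr0.
rewrite le_eqVlt => /predU1P[<-|x0].
  by rewrite p0 set_itvoc0 Rintegral_set0.
pose f (s : R) := s * expR (- s) * q.[expR (- s)].
have cexp : continuous (fun s : R => expR (- s)).
  by move=> s; apply: continuous_comp; [exact: oppr_continuous|exact: continuous_expR].
have cf : continuous f.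
  move=> s; apply: cvgM.
    by apply: cvgM; [exact: cvg_id|exact: cexp].
  by apply: (continuous_comp (cexp s)); exact: continuous_horner.
have cF : continuous (linexp_prim_poly q).
  move=> s; have h := is_derive_linexp_prim_poly q s.
  by apply: differentiable_continuous; apply/derivable1_diffP; exact: ex_derive.
transitivity (\int[lebesgue_measure]_(s in `]0, x]) f s); last first.
  apply: eq_Rintegral => s; rewrite inE/= in_itv/= => /andP[s0 _].
  by rewrite gamma_density21 ?ltW// mul1r.
have intf : lebesgue_measure.-integrable (`[0, x] : set R) (EFin \o f).
  apply: continuous_compact_integrable; first exact: segment_compact.
  exact: continuous_subspaceT.
rewrite Rintegral_itv_obnd_cbnd; last first.
  by apply: integrableS intf => //; exact: subset_itv_oc_cc.
rewrite /Rintegral (@continuous_FTC2 _ _ (linexp_prim_poly q))//.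
- by rewrite p0 sube0.
- exact: continuous_subspaceT.
- split.
  + by move=> s _; have h := is_derive_linexp_prim_poly q s; exact: ex_derive.
  + by apply: cvg_at_right_filter; exact: cF.
  + by apply: cvg_at_left_filter; exact: cF.
- move=> s _; have h := is_derive_linexp_prim_poly q s.
  by rewrite derive1E; exact: derive_val.
Qed.

(** * Karamata's method *)

Lemma ler_norm_max0B (R : realDomainType) (p q : R) :
  `|Num.max 0 p - Num.max 0 q| <= `|p - q|.
Proof.
have h1 := ler_norm (p - q); have h2 := ler_norm (q - p).
rewrite distrC in h2; rewrite ler_norml.
by case: (leP 0 p) => ?; case: (leP 0 q) => ?; apply/andP; split; lra.
Qed.

(** Here [m] is the mass of the bump against [s * e^(-s)]: the primitive of their product is [0] up
    to [alpha] and [m] from [beta] on. On the support, [s^(a - 2)] lies between [beta^(a - 2)] and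
    [alpha^(a - 2)] because [a <= 2], which compares the density of shape [a] with that of shape
    [2]. Since [m] is fixed before [eta], the error can later be taken relative to [m]. *)
Lemma bump_poly_approx (R : realType) (a alpha beta : R) :
  0 < a -> a <= 2 -> 0 < alpha -> alpha < beta ->
  exists2 m, 0 < m & forall eta, 0 < eta -> exists p q : {poly R},
    [/\ forall x, 0 <= x -> linexp_prim_poly p x <= m * (alpha <= x)%R%:R,
        forall x, 0 <= x -> m * (beta <= x)%R%:R <= linexp_prim_poly q x,
        beta `^ (a - 2) * m - eta <=
          Gamma a * \sum_(i < size p) p`_i * i.+1%:R `^ (- a) &
        Gamma a * \sum_(i < size q) q`_i * i.+1%:R `^ (- a) <=
          alpha `^ (a - 2) * m + eta].
Proof.
move=> a0 a2 alpha0 ab; have beta0 := lt_trans alpha0 ab.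
pose A := expR (- beta); pose B := expR (- alpha).
have A0 : 0 < A by exact: expR_gt0.
have AB : A < B by rewrite ltr_expR ltrN2.
have B1 : B <= 1 by rewrite -expR0 ler_expR oppr_le0 ltW.
(* A truncated parabola in [y = e^(-s)], positive exactly for [alpha < s < beta]. It is Lipschitz
   with constant [2] on [[0, 1]], since [A + B - y - z] stays in [[-2, 2]] there. *)
pose h y := Num.max 0 ((y - A) * (B - y)).
have h0 y : 0 <= h y by rewrite le_max lexx.
pose u s := h (expR (- s)).
have u0 s : 0 <= u s by exact: h0.
have hlip y z : 0 <= y <= 1 -> 0 <= z <= 1 -> `|h y - h z| <= 2 * `|y - z|.
  move=> y01 z01.
  apply: (le_trans (ler_norm_max0B _ _)).
  have -> : (y - A) * (B - y) - (z - A) * (B - z) =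
    (A + B - y - z) * (y - z) by ring.
  by rewrite normrM ler_wpM2r// ler_norml; apply/andP; split; lra.
have u_out s : s <= alpha \/ beta <= s -> u s = 0.
  move=> sab; apply/max_idPl; case: sab => [sa|sb].
    have ys : B <= expR (- s) by rewrite ler_expR lerN2.
    by rewrite mulr_ge0_le0// ?subr_ge0 ?subr_le0//; exact: le_trans (ltW AB) ys.
  have ys : expR (- s) <= A by rewrite ler_expR lerN2.
  by rewrite mulr_le0_ge0// ?subr_ge0 ?subr_le0//; exact: le_trans ys (ltW AB).
have u1 s : u s <= 1.
  rewrite /u /h ge_max ler01/=.
  have h1 : (B - A) ^+ 2 <= 1 by rewrite expr_le1// ?subr_ge0 ?ltW//; lra.
  have h2 := sqr_ge0 (2 * expR (- s) - A - B).
  have e4 : 4 * ((expR (- s) - A) * (B - expR (- s))) =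
    (B - A) ^+ 2 - (2 * expR (- s) - A - B) ^+ 2 by ring.
  lra.
have mexp : measurable_fun setT (fun s : R => expR (- s)).
  by apply: measurableT_comp => //; exact: measurable_expR.
have mu' : measurable_fun setT u.
  by apply: measurable_maxr => //; apply: measurable_funM; apply: measurable_funB.
pose f s := gamma_density 2 1 s * u s.
have intbu c : 0 < c -> lebesgue_measure.-integrable (`]0, +oo[ : set R)
    (EFin \o (fun s => gamma_density c 1 s * u s)).
  move=> c0; apply: le_integrable (integrable_gamma_density c0 ltr01) => //.
  - apply/measurable_EFinP; apply: measurable_funM.
      exact: measurable_gamma_density.
    exact: measurable_funTS.
  - move=> s /=; rewrite in_itv/= andbT => s0.
    have g0 := gamma_density_ge0 c 1 s.
    by rewrite lee_fin (ger0_norm (mulr_ge0 g0 (u0 s))) ger0_norm// ler_piMr.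
have R2 : 0 < 2 :> R by lra.
have intf := intbu 2 R2.
have f0 s : 0 <= f s by rewrite mulr_ge0 ?gamma_density_ge0.
pose m := \int[lebesgue_measure]_(s in `]0, +oo[) f s.
have m0 : 0 < m.
  (* On the middle third of [[alpha, beta]] both factors of the parabola stay away from zero. *)
  pose s1 := (2 * alpha + beta) / 3; pose s2 := (alpha + 2 * beta) / 3.
  have s10 : 0 < s1 by rewrite /s1; lra.
  have s12 : s1 < s2 by rewrite /s1 /s2; lra.
  pose c := (alpha * A) * ((expR (- s2) - A) * (B - expR (- s1))).
  have As2 : A < expR (- s2) by rewrite ltr_expR /s2; lra.
  have Bs1 : expR (- s1) < B by rewrite ltr_expR /s1; lra.
  have c0 : 0 < c by rewrite !mulr_gt0// subr_gt0.
  apply: (Rintegral_pos_gt0 intf (fun s _ => f0 s) s10 s12 c0) => s /andP[ss1 ss2].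
  have es2 : expR (- s2) <= expR (- s) by rewrite ler_expR lerN2.
  have es1 : expR (- s) <= expR (- s1) by rewrite ler_expR lerN2.
  have sal : alpha <= s by apply: le_trans ss1; rewrite /s1; lra.
  have sbe : s <= beta by apply: (le_trans ss2); rewrite /s2; lra.
  rewrite /c /f gamma_density21; last by exact: le_trans (ltW alpha0) sal.
  apply: ler_pM.
  - by rewrite mulr_ge0 ?ltW.
  - by rewrite mulr_ge0 ?subr_ge0 ?ltW.
  - by rewrite ler_pM ?(ltW alpha0) ?(ltW A0)// ler_expR mul1r lerN2.
  - rewrite le_max; apply/orP; right.
    by rewrite ler_pM ?subr_ge0 ?(ltW As2) ?(ltW Bs1) ?lerD2r ?lerD2l ?lerN2.
have gdE (s : R) : 0 < s ->
    gamma_density a 1 s = s `^ (a - 2) * gamma_density 2 1 s.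
  move=> s0; rewrite (gamma_density21 _ (ltW s0)) /gamma_density mulrA; congr (_ * _).
  rewrite -[X in _ = _ * X](powRr1 (ltW s0)) -powRD ?(gt_eqF s0) ?implybT//.
  by congr (_ `^ _); lra.
have powR_le (x y : R) : 0 < x -> x <= y -> y `^ (a - 2) <= x `^ (a - 2).
  move=> x0 xy; have y0 := lt_le_trans x0 xy.
  rewrite -[a - 2]opprB !powRN lef_pV2 ?posrE ?powR_gt0//.
  by rewrite ge0_ler_powR// ?nnegrE ?subr_ge0 ?(ltW x0) ?(ltW y0).
have lo (s : R) : 0 < s -> beta `^ (a - 2) * f s <= gamma_density a 1 s * u s.
  move=> s0; have [bs|sb] := leP beta s.
    by rewrite /f u_out ?mulr0//; right.
  rewrite gdE// -mulrA; apply: ler_wpM2r; first exact: f0.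
  by apply: powR_le => //; exact: ltW.
have hi (s : R) : 0 < s -> gamma_density a 1 s * u s <= alpha `^ (a - 2) * f s.
  move=> s0; have [bs|sb] := leP s alpha.
    by rewrite /f u_out ?mulr0//; left.
  rewrite gdE// -mulrA; apply: ler_wpM2r; first exact: f0.
  by apply: powR_le => //; exact: ltW.
exists m => // eta eta0.
have G0 := Gamma_gt0 a0.
(* The shifted polynomials differ from the bump by at most [2 * e], which integrates to [eta]
   against a density of mass [Gamma a]. *)
pose e := eta / (2 * Gamma a).
have e0 : 0 < e by rewrite divr_gt0// mulr_gt0.
have [p0 p0h] := lipschitz_poly_approx e0 hlip.
have es01 (s : R) : 0 <= s -> 0 <= expR (- s) <= 1.
  by move=> s0; rewrite expR_ge0 -[leRHS]expR0 ler_expR oppr_le0.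
have subx x : `]0, x] `<=` (`]0, +oo[ : set R).
  by move=> s /=; rewrite !in_itv/= => /andP[->].
have intq c x (q : {poly R}) : 0 < c ->
    lebesgue_measure.-integrable (`]0, x] : set R)
      (EFin \o (fun s => gamma_density c 1 s * q.[expR (- s)])).
  by move=> c0; apply: integrableS (integrable_gamma_density_poly q c0).
have intfx x : lebesgue_measure.-integrable (`]0, x] : set R) (EFin \o f).
  exact: integrableS intf.
have pu s : 0 <= s -> `|p0.[expR (- s)] - u s| <= e by move=> /es01 /p0h.
have intfZ c : lebesgue_measure.-integrable (`]0, +oo[ : set R)
    (EFin \o (fun s => c * f s)).
  rewrite (_ : EFin \o _ = (fun s => c%:E * (f s)%:E)%E); last first.
    by apply/funext => s; rewrite /= EFinM.
  exact: integrableZl intf.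
(* Shifting the uniform approximation by its error makes it one-sided. *)
exists (p0 - e%:P), (p0 + e%:P); split.
- move=> x x0; rewrite linexp_prim_polyE//.
  apply: (@le_trans _ _ (\int[lebesgue_measure]_(s in `]0, x]) f s)).
    apply: le_Rintegral => //; first by apply: intq; lra.
    move=> s; rewrite /= in_itv/= => /andP[s0 _].
    rewrite ler_wpM2l ?gamma_density_ge0// !hornerE.
    by have := pu s (ltW s0); rewrite ler_norml => /andP[_ ?]; lra.
  have [ax|ax] := leP alpha x; last first.
    rewrite mulr0 (_ : Rintegral _ _ _ = \int[lebesgue_measure]_(s in `]0, x]) cst 0 s).
      by rewrite Rintegral_cst// mul0r.
    apply: eq_Rintegral => s; rewrite inE/= in_itv/= => /andP[_ sx].
    by rewrite /f u_out ?mulr0//; left; lra.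
  rewrite mulr1 /m /Rintegral fine_le//; [exact: integrable_fin_num..|].
  apply: ge0_subset_integral => //; first exact: (measurable_int _ intf).
  by move=> s _; rewrite lee_fin.
- move=> x x0; rewrite linexp_prim_polyE//.
  apply: (@le_trans _ _ (\int[lebesgue_measure]_(s in `]0, x]) f s)); last first.
    apply: le_Rintegral => //; first by apply: intq; lra.
    move=> s; rewrite /= in_itv/= => /andP[s0 _].
    rewrite ler_wpM2l ?gamma_density_ge0// !hornerE.
    by have := pu s (ltW s0); rewrite ler_norml => /andP[? _]; lra.
  have [bx|bx] := leP beta x; last by rewrite mulr0 Rintegral_ge0.
  (* Since [beta <= x], the bump vanishes beyond [x]: the integrals over []0, x]] and over the
     half-line agree once both are extended by zero. *)
  rewrite mulr1 /m Rintegral_mkcond [leRHS]Rintegral_mkcond.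
  rewrite le_eqVlt; apply/orP; left; apply/eqP; congr Rintegral.
  apply/funext => s; rewrite !patchE.
  case: ifPn => sx; case: ifPn => so //.
    have s0 : 0 < s by move: sx; rewrite inE/= in_itv/= andbT.
    move: so; rewrite notin_setE/= in_itv/= s0/= => /negP; rewrite -ltNge => xs.
    by rewrite /f u_out ?mulr0//; right; exact: le_trans bx (ltW xs).
  have /andP[s0 _] : 0 < s <= x by move: so; rewrite inE/= in_itv.
  by move: sx; rewrite notin_setE/= in_itv/= s0.
- rewrite -Rintegral_gamma_density_poly//.
  have -> : beta `^ (a - 2) * m - eta = \int[lebesgue_measure]_(s in `]0, +oo[)
      (beta `^ (a - 2) * f s - (2 * e) * gamma_density a 1 s).
    rewrite (RintegralB _ (intfZ _) (integrable_gamma_densityZ (2 * e) a0 ltr01))//.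
    rewrite !RintegralZl//; last exact: integrable_gamma_density.
    by rewrite -GammaE /e; congr (_ - _); field; rewrite gt_eqF.
  apply: le_Rintegral => //.
  - exact: integrableB (intfZ _) (integrable_gamma_densityZ _ a0 ltr01).
  - exact: integrable_gamma_density_poly.
  - move=> s; rewrite /= in_itv/= andbT => s0; rewrite hornerD hornerN hornerC.
    have h1 := lo s s0.
    have h2 : gamma_density a 1 s * (u s - 2 * e) <=
        gamma_density a 1 s * (p0.[expR (- s)] - e).
      rewrite ler_wpM2l ?gamma_density_ge0//.
      by have := pu s (ltW s0); rewrite ler_norml => /andP[? _]; lra.
    lra.
- rewrite -Rintegral_gamma_density_poly//.
  have -> : alpha `^ (a - 2) * m + eta = \int[lebesgue_measure]_(s in `]0, +oo[)
      (alpha `^ (a - 2) * f s + (2 * e) * gamma_density a 1 s).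
    rewrite (RintegralD _ (intfZ _) (integrable_gamma_densityZ (2 * e) a0 ltr01))//.
    rewrite !RintegralZl//; last exact: integrable_gamma_density.
    by rewrite -GammaE /e; congr (_ + _); field; rewrite gt_eqF.
  apply: le_Rintegral => //.
  - exact: integrable_gamma_density_poly.
  - exact: integrableD (intfZ _) (integrable_gamma_densityZ _ a0 ltr01).
  - move=> s; rewrite /= in_itv/= andbT => s0; rewrite hornerD hornerC.
    have h1 := hi s s0.
    have h2 : gamma_density a 1 s * (p0.[expR (- s)] + e) <=
        gamma_density a 1 s * (u s + 2 * e).
      rewrite ler_wpM2l ?gamma_density_ge0//.
      by have := pu s (ltW s0); rewrite ler_norml => /andP[_ ?]; lra.
    lra.
Qed.

Lemma continuous_linexp_prim (R : realType) (k : R) : 0 < k ->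
  continuous (linexp_prim k).
Proof.
move=> k0 x; have h := is_derive_linexp_prim x k0.
by apply: differentiable_continuous; apply/derivable1_diffP; exact: ex_derive.
Qed.

(** From [1 + k * x <= expR (k * x)]. The bound [k^(-2)] is the integral of [s * e^(-ks)] over the
    whole half-line; boundedness gives integrability under any probability. *)
Lemma linexp_prim_bounds (R : realType) (k x : R) : 0 < k -> 0 <= x ->
  0 <= linexp_prim k x <= k ^- 2.
Proof.
move=> k0 x0; have kx0 : 0 <= k * x by rewrite mulr_ge0 ?(ltW k0).
have h : (1 + k * x) * expR (- (k * x)) <= 1.
  by rewrite expRN ler_pdivrMr ?expR_gt0// mul1r expR_ge1Dx.
have h' : 0 <= (1 + k * x) * expR (- (k * x)).
  by rewrite mulr_ge0 ?expR_ge0// addr_ge0.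
rewrite /linexp_prim divr_ge0 ?subr_ge0 ?sqr_ge0//=.
apply: ler_piMl; first by rewrite invr_ge0 sqr_ge0.
by rewrite gerBl.
Qed.

Section LinexpRandomVariable.
Context {R : realType} {d : measure_display} {Omega : measurableType d}.
Variables (P : probability Omega R) (X : Omega -> R).
Hypotheses (mX : measurable_fun setT X) (X0 : forall w, 0 <= X w).

Lemma integrable_linexp_prim (c k : R) : 0 < k ->
  P.-integrable setT (EFin \o (fun w => c * linexp_prim k (X w))).
Proof.
move=> k0; apply: measurable_bounded_integrable => //.
- by rewrite (le_lt_trans (probability_le1 _ _))// ltry.
- apply: measurable_funM => //; apply: measurableT_comp => //.
  by apply: continuous_measurable_fun; exact: continuous_linexp_prim.
- exists (`|c| * k ^- 2); split; first exact: num_real.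
  move=> M M1 w _ /=.
  rewrite (le_trans _ (ltW M1))// normrM ler_wpM2l//.
  have /andP[l0 l1] := linexp_prim_bounds k0 (X0 w).
  by rewrite ger0_norm.
Qed.

Lemma integrable_linexp_prim_poly (q : {poly R}) :
  P.-integrable setT (EFin \o (fun w => linexp_prim_poly q (X w))).
Proof.
rewrite (_ : EFin \o _ =
  (fun w => (\sum_(i < size q) (q`_i * linexp_prim i.+1%:R (X w))%:E)%E)).
  by apply: integrable_sum => // i _; apply: integrable_linexp_prim; rewrite ltr0n.
by apply/funext => s; rewrite /= sumEFin.
Qed.

Lemma Rintegral_linexp_prim_poly (q : {poly R}) :
  \int[P]_w linexp_prim_poly q (X w) =
  \sum_(i < size q) q`_i * \int[P]_w linexp_prim i.+1%:R (X w).
Proof.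
rewrite /linexp_prim_poly.
have int i : P.-integrable setT
    (EFin \o (fun w => q`_i * linexp_prim i.+1%:R (X w))).
  by apply: integrable_linexp_prim; rewrite ltr0n.
elim: (size q) => [|n IHn].
  under eq_Rintegral do rewrite big_ord0.
  by rewrite big_ord0 Rintegral_cst// mul0r.
under eq_Rintegral do rewrite big_ord_recr/=.
rewrite RintegralD//; last first.
  rewrite (_ : EFin \o _ =
    (fun w => (\sum_(i < n) (q`_i * linexp_prim i.+1%:R (X w))%:E)%E)).
    by apply: integrable_sum => // i _; exact: int.
  by apply/funext => s; rewrite /= sumEFin.
rewrite IHn RintegralZl ?big_ord_recr//.
rewrite (_ : EFin \o _ = EFin \o (fun w => 1 * linexp_prim n.+1%:R (X w))).
  by apply: integrable_linexp_prim; rewrite ltr0n.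
by apply/funext => w; rewrite /= mul1r.
Qed.

Lemma linexp_prim_poly_close (q : {poly R}) (a delta N : R) :
  (forall k, (k < size q)%N ->
    `|(\int[P]_w linexp_prim k.+1%:R (X w)) / N - k.+1%:R `^ (- a)| <= delta) ->
  `|(\int[P]_w linexp_prim_poly q (X w)) / N -
    \sum_(i < size q) q`_i * i.+1%:R `^ (- a)| <=
  delta * \sum_(i < size q) `|q`_i|.
Proof.
move=> h; rewrite Rintegral_linexp_prim_poly mulr_suml -sumrB mulr_sumr.
apply: le_trans (ler_norm_sum _ _ _) _; apply: ler_sum => i _.
by rewrite -mulrA -mulrBr normrM mulrC ler_wpM2r// h.
Qed.

Lemma Rintegral_tail (m : R) :
  P.-integrable setT (EFin \o (fun w => m * (1 <= X w)%R%:R)) /\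
  \int[P]_w (m * (1 <= X w)%R%:R) = m * fine (P [set w | 1 <= X w]).
Proof.
have mA : measurable [set w | 1 <= X w].
  rewrite (_ : [set _ | _] = X @^-1` `[1, +oo[%classic).
    by rewrite -[_ @^-1` _]setTI; exact: mX.
  by apply/seteqP; split => w /=; rewrite in_itv/= andbT.
have E : (fun w => (1 <= X w)%R%:R) = \1_[set w | 1 <= X w] :> (Omega -> R).
  by apply/funext => w; rewrite indicE; congr (nat_of_bool _)%:R; apply/idP/idP; rewrite inE.
have int : P.-integrable setT (EFin \o (fun w => (1 <= X w)%R%:R : R)).
  by rewrite E; apply: integrable_indic.
split; last by rewrite RintegralZl//; congr (_ * _); rewrite E /Rintegral integral_indic// setIT.
rewrite (_ : EFin \o _ = (fun w => m%:E * ((1 <= X w)%R%:R)%:E)%E); last first.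
  by apply/funext => w; rewrite /= EFinM.
exact: integrableZl int.
Qed.

End LinexpRandomVariable.

(** A finite form of Karamata's theorem: only the rates occurring in one minorizing and one
    majorizing polynomial matter. As [K] and [delta] are chosen before the space, [X] and [N], the
    estimate is uniform in these, as a joint limit in [t] and [r] requires. *)
Lemma tauberian_tail (R : realType) (a eps : R) : 0 < a -> a <= 2 -> 0 < eps ->
  exists (K : nat) (delta : R), 0 < delta /\
  forall (d : measure_display) (Omega : measurableType d)
    (P : probability Omega R) (X : Omega -> R) (N : R),
    measurable_fun setT X -> (forall w, 0 <= X w) -> 0 < N ->
    (forall k, (k < K)%N ->
      `|(\int[P]_w linexp_prim k.+1%:R (X w)) / N - k.+1%:R `^ (- a)| <= delta) ->
    `|fine (P [set w | 1 <= X w]) / N - (Gamma a)^-1| < eps.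
Proof.
move=> a0 a2 eps0; have G0 := Gamma_gt0 a0; set G := Gamma a in G0 *.
(* With [kappa <= 1], the square of [c = 1 + kappa] is at most [1 + 3 * kappa], hence at most
   [1 + eps * G / 3]. *)
pose kappa := Num.min 1 (eps * G / 9).
have kappa0 : 0 < kappa by rewrite lt_min ltr01 divr_gt0// mulr_gt0.
have kappa1 : kappa <= 1 by rewrite ge_min lexx.
have kappaE : kappa <= eps * G / 9 by rewrite ge_min lexx orbT.
pose c := 1 + kappa.
have c1 : 1 < c by rewrite ltrDl.
have c0 : 0 < c by exact: lt_trans c1.
have cc : c ^+ 2 <= 1 + eps * G / 3.
  have : kappa ^+ 2 <= kappa by rewrite expr2 ler_piMl// ltW.
  have -> : c ^+ 2 = 1 + 2 * kappa + kappa ^+ 2 by rewrite /c; ring.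
  lra.
have pc : c `^ (2 - a) <= c ^+ 2.
  by rewrite -powR_mulrn ?(ltW c0)// ler_powR ?(ltW c1)//; lra.
have pc0 : 0 < c `^ (2 - a) by rewrite powR_gt0.
(* With [u = eps * G / 3], this follows from [c^(2 - a) <= 1 + u] and [(1 - u) * (1 + u) <= 1]; a
   nonpositive [1 - u] is treated apart. *)
have cl : 1 - eps * G / 3 <= c `^ (a - 2).
  rewrite -[a - 2]opprB powRN -[leRHS]mul1r ler_pdivlMr//.
  have g0 : 0 < eps * G by rewrite mulr_gt0.
  have [e1|e1] := leP (1 - eps * G / 3) 0.
    by rewrite (le_trans (mulr_le0_ge0 e1 (ltW pc0))).
  apply: (@le_trans _ _ ((1 - eps * G / 3) * (1 + eps * G / 3))).
    by rewrite ler_wpM2l ?(ltW e1)// (le_trans pc).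
  have := sqr_ge0 (eps * G / 3); lra.
have cu : c^-1 `^ (a - 2) <= 1 + eps * G / 3.
  by rewrite -[c^-1]powR_inv1 ?(ltW c0)// powRAC powR_inv1 ?powR_ge0// -powRN opprB (le_trans pc).
have ic0 : 0 < c^-1 by rewrite invr_gt0.
have ic1 : c^-1 < 1 by rewrite invf_lt1.
(* The interval [[1, c]] serves the lower bound and [[c^-1, 1]] the upper one. The tolerance becomes
   [eps / 6] after division by [m1 * G]. *)
have [m1 m10 /(_ (m1 * G * eps / 6))] := bump_poly_approx a0 a2 ltr01 c1.
case=> [|p [_ [p1 _ p2 _]]]; first by rewrite divr_gt0// !mulr_gt0.
have [m2 m20 /(_ (m2 * G * eps / 6))] := bump_poly_approx a0 a2 ic0 ic1.
case=> [|_ [q [_ q1 _ q2]]]; first by rewrite divr_gt0// !mulr_gt0.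
(* The summand [1] keeps the divisors in [delta] positive even when all coefficients vanish. *)
pose Ap := 1 + \sum_(i < size p) `|p`_i|; pose Aq := 1 + \sum_(i < size q) `|q`_i|.
have Ap0 : 0 < Ap by rewrite ltr_pwDl// sumr_ge0.
have Aq0 : 0 < Aq by rewrite ltr_pwDl// sumr_ge0.
pose delta := Num.min (m1 * eps / (6 * Ap)) (m2 * eps / (6 * Aq)).
have d0 : 0 < delta by rewrite lt_min !divr_gt0 ?mulr_gt0.
have dp : delta * \sum_(i < size p) `|p`_i| <= m1 * eps / 6.
  apply: (@le_trans _ _ (m1 * eps / (6 * Ap) * Ap)).
    by rewrite ler_pM ?(ltW d0) ?sumr_ge0// ?ge_min ?lexx// lerDr.
  by rewrite le_eqVlt; apply/orP; left; apply/eqP; field; rewrite gt_eqF.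
have dq : delta * \sum_(i < size q) `|q`_i| <= m2 * eps / 6.
  apply: (@le_trans _ _ (m2 * eps / (6 * Aq) * Aq)).
    by rewrite ler_pM ?(ltW d0) ?sumr_ge0// ?ge_min ?lexx ?orbT// lerDr.
  by rewrite le_eqVlt; apply/orP; left; apply/eqP; field; rewrite gt_eqF.
exists (maxn (size p) (size q)), delta; split => // d Omega P X N mX X0 N0 HN.
have [it1 t1] := Rintegral_tail P mX m1; have [it2 t2] := Rintegral_tail P mX m2.
have cp := @linexp_prim_poly_close _ _ _ P X mX X0 p a delta N
  (fun k kp => HN k (leq_trans kp (leq_maxl _ _))).
have cq := @linexp_prim_poly_close _ _ _ P X mX X0 q a delta N
  (fun k kp => HN k (leq_trans kp (leq_maxr _ _))).
set tail := fine _ in t1 t2 *.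
have lop : (\int[P]_w linexp_prim_poly p (X w)) / N <= m1 * (tail / N).
  rewrite mulrA ler_pM2r ?invr_gt0// -t1; apply: le_Rintegral => //.
    exact: integrable_linexp_prim_poly.
  by move=> w _; exact: p1.
have hiq : m2 * (tail / N) <= (\int[P]_w linexp_prim_poly q (X w)) / N.
  rewrite mulrA ler_pM2r ?invr_gt0// -t2; apply: le_Rintegral => //.
    exact: integrable_linexp_prim_poly.
  by move=> w _; exact: q1.
move: cp cq p2 q2; rewrite !ler_norml -/G => /andP[cp _] /andP[_ cq] p2 q2.
set x := tail / N in lop hiq *.
set sp := \sum_(i < size p) p`_i * _ in cp p2.
set sq := \sum_(i < size q) q`_i * _ in cq q2.
have iG : G * G^-1 = 1 by rewrite divff// gt_eqF.
have iG0 : 0 < G^-1 by rewrite invr_gt0.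
(* On each side the loss is [eps / 3] from the width of the interval, [eps / 6] from the polynomial
   and [eps / 6] from [delta], in total less than [eps]. *)
rewrite ltr_norml; apply/andP; split.
  have : G^-1 * (c `^ (a - 2) * m1 - m1 * G * eps / 6) <= sp.
    by rewrite ler_pdivrMl.
  have : G^-1 * m1 * (1 - eps * G / 3) <= G^-1 * m1 * c `^ (a - 2).
    by rewrite ler_wpM2l ?mulr_ge0 ?(ltW m10) ?(ltW iG0).
  have -> : G^-1 * m1 * (1 - eps * G / 3) = m1 * G^-1 - m1 * eps / 3.
    by field; rewrite gt_eqF.
  have -> : G^-1 * (c `^ (a - 2) * m1 - m1 * G * eps / 6) =
    G^-1 * m1 * c `^ (a - 2) - m1 * eps / 6 by field; rewrite gt_eqF.
  move=> h1 h2; rewrite -(ltr_pM2l m10) mulrBr.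
  have : 0 < m1 * eps by rewrite mulr_gt0.
  lra.
have : sq <= G^-1 * (c^-1 `^ (a - 2) * m2 + m2 * G * eps / 6).
  by rewrite ler_pdivlMl.
have : G^-1 * m2 * c^-1 `^ (a - 2) <= G^-1 * m2 * (1 + eps * G / 3).
  by rewrite ler_wpM2l ?mulr_ge0 ?(ltW m20) ?(ltW iG0).
have -> : G^-1 * m2 * (1 + eps * G / 3) = m2 * G^-1 + m2 * eps / 3.
  by field; rewrite gt_eqF.
have -> : G^-1 * (c^-1 `^ (a - 2) * m2 + m2 * G * eps / 6) =
  G^-1 * m2 * c^-1 `^ (a - 2) + m2 * eps / 6 by field; rewrite gt_eqF.
move=> h1 h2; rewrite -(ltr_pM2l m20) mulrBr.
have : 0 < m2 * eps by rewrite mulr_gt0.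
lra.
Qed.

(** * Laplace exponents of subordinators *)

Lemma laplace_integrable (R : realType) (d : measure_display)
    (Omega : measurableType d) (P : probability Omega R) (X : Omega -> R)
    (l : R) :
  measurable_fun setT X -> (forall w, 0 <= X w) -> 0 <= l ->
  P.-integrable setT (EFin \o (fun w => expR (- l * X w))).
Proof.
move=> mX X0 l0; apply: measurable_bounded_integrable => //.
- by rewrite (le_lt_trans (probability_le1 _ _))// ltry.
- by apply: measurableT_comp => //; exact: measurable_funM.
- exists 1; split => // M M1 w _ /=.
  rewrite ger0_norm ?expR_ge0// (le_trans _ (ltW M1))//.
  by rewrite -expR0 ler_expR mulNr oppr_le0 mulr_ge0.
Qed.

Lemma mulr_expRN_le (R : realType) (c x : R) : 0 < c -> x * expR (- c * x) <= c^-1.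
Proof.
move=> c0; rewrite mulNr expRN ler_pdivrMr ?expR_gt0// mulrC ler_pdivlMr//.
by rewrite mulrC (le_trans _ (expR_ge1Dx _))// lerDr.
Qed.

(** Differentiation under the integral on []l / 2, l + 1[]: there [x * e^(-y * x) <= (l / 2)^-1] for
    [x >= 0], a constant and hence integrable under a probability. *)
Lemma is_derive_laplace (R : realType) (d : measure_display)
    (Omega : measurableType d) (P : probability Omega R) (X : Omega -> R)
    (l : R) :
  measurable_fun setT X -> (forall w, 0 <= X w) -> 0 < l ->
  is_derive l 1 (fun l => \int[P]_w expR (- l * X w))
    (- \int[P]_w (X w * expR (- l * X w))).
Proof.
move=> mX X0 l0.
pose f (l : R) (w : Omega) := expR (- l * X w).
have df (y : R) w : is_derive y 1 (f ^~ w) (- (X w * f y w)).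
  rewrite /f.
  have h : is_derive y 1 (fun y : R => - y * X w) (- X w).
    by apply: is_derive_eq; rewrite scaler0 add0r /GRing.scale/= mulrN1.
  have -> : - (X w * expR (- y * X w)) = expR (- y * X w) * - X w by ring.
  exact: (is_derive1_comp (is_derive_expR _) h).
have d1E y w : partial1of2 f y w = - (X w * f y w).
  by rewrite partial1of2E; have := df y w => h; apply: derive_val.
have Il : l \in `]l / 2, l + 1[ by rewrite in_itv/=; lra.
have iI (x : R) : `]l / 2, l + 1[%classic x -> 0 <= x.
  by rewrite /= in_itv/= => /andP[]; lra.
have G0 : forall w : Omega, 0 <= cst (l / 2)^-1 w.
  by move=> w; rewrite /= invr_ge0; lra.
have intG : P.-integrable setT (EFin \o cst (l / 2)^-1).
  exact: finite_measure_integrable_cst.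
have ub : forall x w, `]l / 2, l + 1[%classic x -> setT w ->
    `|partial1of2 f x w| <= cst (l / 2)^-1 w.
  move=> x w; rewrite /= in_itv/= => /andP[x1 _] _.
  rewrite d1E normrN ger0_norm ?mulr_ge0 ?expR_ge0//.
  apply: le_trans (mulr_expRN_le (X w) _); last by lra.
  rewrite ler_wpM2l// ler_expR !mulNr lerN2 ler_wpM2r// ltW//.
have intf x : `]l / 2, l + 1[%classic x -> P.-integrable setT (EFin \o f x).
  by move=> /iI x0; exact: laplace_integrable.
have dfx (x : R) w : `]l / 2, l + 1[%classic x -> setT w -> derivable (f ^~ w) x 1.
  by move=> _ _; have := df x w => h; exact: ex_derive.
have D := derivable_under_integral measurableT Il intf dfx G0 intG ub.
have := differentiation_under_integral measurableT Il intf dfx G0 intG ub.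
rewrite derive1E => E; apply: DeriveDef => //.
rewrite E -[RHS]mulN1r -RintegralZl//; last first.
  apply: (@le_integrable _ _ _ _ _ _ _ (EFin \o cst (l / 2)^-1)) => //.
    apply/measurable_EFinP; apply: measurable_funM => //.
    by apply: measurableT_comp => //; exact: measurable_funM.
  move=> w _ /=; rewrite lee_fin -normrN -d1E [leRHS]ger0_norm ?ub//=.
  by rewrite invr_ge0; lra.
by apply: eq_Rintegral => w _; rewrite d1E mulN1r.
Qed.

Section LaplaceExponent.
Context {R : realType} {d : measure_display} {Omega : measurableType d}.
Context {P : probability Omega R} {T : R -> Omega -> R} {phi : R -> R}.
Hypotheses (subT : subordinator P T) (lapT : laplace_exponent P T phi).

Lemma subordinator_ge0 (t : R) w : 0 <= t -> 0 <= T t w.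
Proof.
by move=> t0; case: subT => _ [T0 [Tm _]]; rewrite -(T0 w) Tm.
Qed.

Lemma measurable_subordinator (t : R) : 0 <= t -> measurable_fun setT (T t).
Proof. by case: subT => + _; apply. Qed.

Lemma Rintegral_laplace (t l : R) : 0 <= t -> 0 < l ->
  \int[P]_w expR (- l * T t w) = expR (- t * phi l).
Proof. by move=> t0 l0; rewrite /Rintegral lapT. Qed.

Lemma is_derive_laplace_subordinator (t l : R) : 0 <= t -> 0 < l ->
  is_derive l 1 (fun l => expR (- t * phi l))
    (- \int[P]_w (T t w * expR (- l * T t w))).
Proof.
move=> t0 l0.
have := is_derive_laplace P (measurable_subordinator t0)
  (fun w => subordinator_ge0 w t0) l0.
(* The two functions are known to agree only at positive arguments, which is enough near [l]. *)
apply: near_eq_is_derive.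
near=> x; rewrite Rintegral_laplace//.
by near: x; exact: lt_nbhsr.
Unshelve. all: by end_near. Qed.

(** At time [1], [phi] is minus the logarithm of a differentiable positive function. *)
Lemma derivable_laplace_exponent (l : R) : 0 < l -> derivable phi l 1.
Proof.
move=> l0.
have -> : phi = fun l => - ln (expR (- 1 * phi l)).
  by apply/funext => x; rewrite expRK mulN1r opprK.
have h := is_derive_laplace_subordinator ler01 l0.
have h' := @is_derive1_comp _ (@ln R) (fun l => expR (- 1 * phi l)) l _ _
  (is_derive1_ln (expR_gt0 _)) h.
by have h2 := is_deriveN h'; exact: (@ex_derive _ _ _ _ _ _ _ h2).
Qed.

(** The derivative of [expR (- t * phi l)] is computed twice, under the integral and by the chain
    rule. *)
Lemma laplace_exponent_moment (t l : R) : 0 <= t -> 0 < l ->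
  \int[P]_w (T t w * expR (- l * T t w)) =
  t * derive1 phi l * expR (- t * phi l).
Proof.
move=> t0 l0.
have h := is_derive_laplace_subordinator t0 l0.
have /derivableP dphi := derivable_laplace_exponent l0.
have h1 : is_derive l 1 (fun l => - t * phi l) (- t * 'D_1 phi l).
  exact: (is_deriveZ (- t) dphi).
have h2 := @is_derive1_comp _ (@expR R) (fun l => - t * phi l) l _ _
  (is_derive_expR _) h1.
have := @derive_val _ _ _ _ _ _ _ h.
rewrite (@derive_val _ _ _ _ _ _ _ h2) derive1E => /eqP.
rewrite eq_sym eqr_oppLR => /eqP ->; ring.
Qed.

Lemma laplace_exponent_ge0 (l : R) : 0 < l -> 0 <= phi l.
Proof.
move=> l0; have E := Rintegral_laplace ler01 l0.
have : expR (- 1 * phi l) <= 1.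
  have e : \int[P]_w (cst 1 w) = 1 :> R.
    have m : fine (P setT) = 1 by rewrite probability_setT.
    by rewrite Rintegral_cst// mul1r; exact: m.
  rewrite -E -[leRHS]e.
  apply: le_Rintegral => //.
  - exact: (laplace_integrable P (measurable_subordinator ler01)
      (fun w => subordinator_ge0 w ler01) (ltW l0)).
  - exact: finite_measure_integrable_cst.
  - move=> w _ /=; rewrite -expR0 ler_expR mulNr oppr_le0 mulr_ge0 ?(ltW l0)//.
    exact: subordinator_ge0.
by rewrite -[leRHS]expR0 ler_expR mulN1r oppr_le0.
Qed.

Lemma derive1_laplace_exponent_ge0 (l : R) : 0 < l -> 0 <= derive1 phi l.
Proof.
move=> l0; have := laplace_exponent_moment ler01 l0.
rewrite mul1r => /(congr1 (fun x => 0 <= x)).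
rewrite pmulr_lge0 ?expR_gt0// => <-.
apply: Rintegral_ge0 => w _.
by rewrite mulr_ge0 ?expR_ge0// subordinator_ge0.
Qed.

Hypothesis H0 : forall l, 0 < l -> 0 < phi l - l * derive1 phi l.

(* [phi l / l] is nonincreasing, its derivative being [- H l / l ^ 2]. *)
Lemma laplace_exponent_mulr_le (l k : R) : 0 < l -> 1 <= k -> phi (k * l) <= k * phi l.
Proof.
move=> l0 k1.
have d1 (x : R) : 0 < x -> is_derive x 1 (fun x : R => phi x / x)
    (- ((phi x - x * derive1 phi x) / x ^+ 2)).
  move=> x0; have /derivableP dphi := derivable_laplace_exponent x0.
  have dV : is_derive x 1 (fun x : R => x^-1) (- x ^- 2 *: 1).
    by apply: is_deriveV; rewrite gt_eqF.
  have := is_deriveM dphi dV; congr is_derive.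
  by rewrite /GRing.scale/= derive1E; field; rewrite gt_eqF.
have lkl : l <= k * l by rewrite ler_peMl// ltW.
have kl0 := lt_le_trans l0 lkl.
suff : phi (k * l) / (k * l) <= phi l / l.
  rewrite ler_pdivrMr// => /le_trans; apply.
  by rewrite le_eqVlt; apply/orP; left; apply/eqP; field; rewrite gt_eqF.
apply: (@ler0_derive1_nincr _ (fun x => phi x / x) l (k * l)) => //.
- move=> x; rewrite in_itv/= => /andP[x0 _].
  by have h := d1 x (lt_trans l0 x0); exact: ex_derive.
- move=> x; rewrite in_itv/= => /andP[lx _]; have x0 := lt_trans l0 lx.
  have h := d1 x x0; rewrite derive1E derive_val oppr_le0.
  by rewrite divr_ge0 ?sqr_ge0// ltW// H0.
- apply: derivable_within_continuous => x; rewrite in_itv/= => /andP[x0 _].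
  by have h := d1 x (lt_le_trans l0 x0); exact: ex_derive.
Qed.

End LaplaceExponent.

(** The difference equals [y * (1 - e^(-x)) - (e^(-x) - 1 + x)], and both terms subtracted here lie
    in [[0, x^2]]. *)
Lemma expR_linear_remainder (R : realType) (x y : R) : 0 <= y -> y <= x ->
  `|1 - expR (- x) - y * expR (- x) - (x - y)| <= x ^+ 2.
Proof.
move=> y0 yx; have x0 := le_trans y0 yx.
have e1 : 1 - x <= expR (- x) by exact: expR_ge1Dx.
have e2 : expR (- x) <= 1 by rewrite -expR0 ler_expR oppr_le0.
have e3 : expR (- x) <= 1 - x + x ^+ 2.
  rewrite expRN; apply: (@le_trans _ _ (1 + x)^-1).
    by rewrite lef_pV2 ?posrE ?expR_gt0 ?expR_ge1Dx// ltr_pwDl.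
  rewrite -[leLHS]mul1r ler_pdivrMr ?ltr_pwDl//.
  have -> : (1 - x + x ^+ 2) * (1 + x) = 1 + x ^+ 3 by ring.
  by rewrite lerDl exprn_ge0.
have e4 : 0 <= y * (1 - expR (- x)) by rewrite mulr_ge0 ?subr_ge0.
have e5 : y * (1 - expR (- x)) <= x ^+ 2.
  by rewrite expr2 ler_pM ?subr_ge0//; lra.
by rewrite ler_norml; apply/andP; split; lra.
Qed.

(** * Transfer to the tail of the subordinator *)

Section TailAsymptotics.
Context {R : realType} {d : measure_display} {Omega : measurableType d}.
Context {P : probability Omega R} {T : R -> Omega -> R} {phi : R -> R}.
Hypotheses (subT : subordinator P T) (lapT : laplace_exponent P T phi).
Let H lam := phi lam - lam * derive1 phi lam.
Hypothesis H0 : forall l, 0 < l -> 0 < H l.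

Lemma Rintegral_linexp_prim_subordinator (t r k : R) :
  0 <= t -> 0 < r -> 0 < k ->
  \int[P]_w linexp_prim k (T t w / r) =
  (1 - expR (- (t * phi (k / r))) -
   t * (k / r * derive1 phi (k / r)) * expR (- (t * phi (k / r)))) / k ^+ 2.
Proof.
move=> t0 r0 k0; have l0 : 0 < k / r by rewrite divr_gt0.
pose E w := expR (- (k / r) * T t w).
have mT := measurable_subordinator subT t0.
have T0 w := subordinator_ge0 subT w t0.
have iE : P.-integrable setT (EFin \o E) := laplace_integrable P mT T0 (ltW l0).
have i1 : P.-integrable setT (EFin \o cst (1 : R)).
  exact: finite_measure_integrable_cst.
have iTE : P.-integrable setT (EFin \o (fun w => T t w * E w)).
  apply: (@le_integrable _ _ _ _ _ _ _ (EFin \o cst (k / r)^-1)) => //.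
  - apply/measurable_EFinP; apply: measurable_funM => //.
    by have /measurable_int/measurable_EFinP := iE.
  - move=> w _ /=; rewrite lee_fin !ger0_norm ?invr_ge0 ?(ltW l0)//.
      exact: mulr_expRN_le.
    by rewrite mulr_ge0 ?expR_ge0.
  - exact: finite_measure_integrable_cst.
(* The integrand is rewritten through [E] and [T t * E], whose expectations are the Laplace
   transform at [k / r] and the moment given by its derivative. *)
transitivity (\int[P]_w (k ^- 2 * ((1 - E w) - (k / r) * (T t w * E w)))).
  apply: eq_Rintegral => w _; rewrite /linexp_prim /E.
  rewrite (_ : - (k * (T t w / r)) = - (k / r) * T t w); last by field; rewrite gt_eqF.
  by field; rewrite !gt_eqF.
have i2 : P.-integrable setT (EFin \o (fun w => 1 - E w)) := integrableB measurableT i1 iE.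
have i3 : P.-integrable setT (EFin \o (fun w => (k / r) * (T t w * E w))).
  rewrite (_ : EFin \o _ = (fun w => (k / r)%:E * (T t w * E w)%:E)%E); last first.
    by apply/funext => w; rewrite /= EFinM.
  exact: integrableZl iTE.
rewrite RintegralZl//; last exact: (integrableB measurableT i2 i3).
rewrite (RintegralB _ i2 i3)// (RintegralB _ i1 iE)// RintegralZl//.
rewrite (laplace_exponent_moment subT lapT t0 l0) (Rintegral_laplace lapT t0 l0).
have m : fine (P setT) = 1 by rewrite probability_setT.
rewrite Rintegral_cst// (_ : fine _ = 1); last exact: m.
by rewrite mulNr; field; rewrite !gt_eqF.
Qed.

(** The first error is that of regular variation. The second is the quadratic remainder: [1 <= k]
    gives [phi (k / r) <= k * phi (1 / r)], and the resulting [k^2] cancels against the factor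
    [k^(-2)] of the primitive. *)
Lemma linexp_prim_subordinator_close (t r k g : R) :
  0 < t -> 0 < r -> 1 <= k ->
  `|(\int[P]_w linexp_prim k (T t w / r)) / (t * H r^-1) - k `^ (- (2 - g))| <=
  `|H (k * r^-1) / H r^-1 - k `^ g| + `|t * phi r^-1 ^+ 2 / H r^-1|.
Proof.
move=> t0 r0 k1; have k0 := lt_le_trans ltr01 k1.
have ir0 : 0 < r^-1 by rewrite invr_gt0.
have l0 : 0 < k / r by rewrite divr_gt0.
have Hr := H0 ir0; have Hk := H0 l0.
have N0 : 0 < t * H r^-1 by rewrite mulr_gt0.
rewrite (Rintegral_linexp_prim_subordinator (ltW t0) r0 k0).
set x := t * phi (k / r); set y := t * (k / r * derive1 phi (k / r)).
have y0 : 0 <= y.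
  apply: mulr_ge0 (ltW t0) (mulr_ge0 (ltW l0) _).
  exact: derive1_laplace_exponent_ge0 subT lapT _ l0.
have xy : x - y = t * H (k / r) by rewrite /x /y /H; ring.
have yx : y <= x by rewrite -subr_ge0 xy mulr_ge0 ?ltW.
have rem := expR_linear_remainder y0 yx.
have x2 : x ^+ 2 <= k ^+ 2 * (t * phi r^-1) ^+ 2.
  rewrite -exprMn ler_sqr ?nnegrE.
  - rewrite /x mulrCA ler_wpM2l ?(ltW t0)//.
    exact: (laplace_exponent_mulr_le subT lapT H0 ir0 k1).
  - exact: le_trans y0 yx.
  - by rewrite !mulr_ge0 ?(ltW k0) ?(ltW t0)// (laplace_exponent_ge0 subT lapT).
set z := 1 - _ - _ in rem *.
have -> : k `^ (- (2 - g)) = k `^ g / k ^+ 2.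
  rewrite opprB powRD ?(gt_eqF k0) ?implybT// powRN.
  by rewrite powR_mulrn ?(ltW k0).
have -> : z / k ^+ 2 / (t * H r^-1) - k `^ g / k ^+ 2 =
    ((H (k / r) / H r^-1 - k `^ g) + (z - (x - y)) / (t * H r^-1)) / k ^+ 2.
  by rewrite xy; field; rewrite !gt_eqF.
set A := H (k / r) / H r^-1 - k `^ g; set B := (z - (x - y)) / (t * H r^-1).
set C := t * phi r^-1 ^+ 2 / H r^-1.
have C0 : 0 <= C := divr_ge0 (mulr_ge0 (ltW t0) (sqr_ge0 _)) (ltW Hr).
have BC : `|B| <= k ^+ 2 * C.
  rewrite /B normrM (gtr0_norm (x := _^-1)) ?invr_gt0// ler_pdivrMr//.
  apply: le_trans rem (le_trans x2 _).
  by rewrite le_eqVlt; apply/orP; left; apply/eqP; rewrite /C; field; rewrite !gt_eqF.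
have k20 : 0 < k ^+ 2 by rewrite exprn_gt0.
rewrite normrM (ger0_norm C0) (gtr0_norm (x := k ^- 2)) ?invr_gt0//.
rewrite ler_pdivrMr//; apply: le_trans (ler_normD _ _) _.
rewrite mulrDl [C * _]mulrC lerD//.
by apply: ler_peMr => //; exact: exprn_ege1.
Qed.

(** Regular variation enters only through finitely many ratios at the point [r^-1], so the same
    estimate serves both limits of [r]. *)
Lemma tail_asymptotics (g eps : R) : 0 <= g -> g < 2 -> 0 < eps ->
  exists (K : nat) (delta : R), 0 < delta /\ forall t r, 0 < t -> 0 < r ->
    (forall k, (k < K)%N ->
      `|H (k.+1%:R * r^-1) / H r^-1 - k.+1%:R `^ g| < delta) ->
    `|t * phi r^-1 ^+ 2 / H r^-1| < delta ->
    `|fine (P [set w | r <= T t w]) / ((Gamma (2 - g))^-1 * t * H r^-1) - 1| < eps.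
Proof.
move=> g0 g2 eps0; have a0 : 0 < 2 - g by rewrite subr_gt0.
have a2 : 2 - g <= 2 by rewrite gerBl.
have G0 := Gamma_gt0 a0.
(* The tolerance is divided by [Gamma (2 - g)] because the final ratio multiplies the tail by it;
   [delta] is halved below to share it between two errors. *)
have [K [delta [delta0 tail]]] := tauberian_tail a0 a2 (divr_gt0 eps0 G0).
exists K, (delta / 2); split; first by rewrite divr_gt0.
move=> t r t0 r0 HK herr.
have Hr : 0 < H r^-1 by rewrite H0// invr_gt0.
have N0 : 0 < t * H r^-1 by rewrite mulr_gt0.
have mX : measurable_fun setT (fun w => T t w / r).
  have mT := measurable_subordinator subT (ltW t0).
  by apply: (measurable_funM mT).
have X0 w : 0 <= T t w / r.
  by rewrite divr_ge0 ?(ltW r0)// (subordinator_ge0 subT _ (ltW t0)).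
have := tail d Omega P _ _ mX X0 N0.
have -> : [set w | 1 <= T t w / r] = [set w | r <= T t w].
  by apply/seteqP; split => w /=; rewrite ler_pdivlMr// mul1r.
move=> /(_ _)/wrap[k kK|].
  apply: le_trans (linexp_prim_subordinator_close g t0 r0 _) _; first by rewrite ler1n.
  by have := HK k kK; lra.
rewrite ltr_pdivlMr// -[X in _ * X](gtr0_norm G0) -normrM.
congr (`|_| < _); field; rewrite !gt_eqF//.
Qed.

End TailAsymptotics.

(** A filter is closed under finite intersections; keeping it abstract covers [0^'+] and [+oo] at
    once. *)
Lemma near_regvar (R : realType) (F : set_system R) {FF : Filter F}
    (l : R -> R) (g delta : R) (K : nat) : 0 < delta ->
  (forall lam, 0 < lam -> (fun s => l (lam * s) / l s) @ F --> lam `^ g) ->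
  \forall s \near F, forall k, (k < K)%N ->
    `|l (k.+1%:R * s) / l s - k.+1%:R `^ g| < delta.
Proof.
move=> d0 lF; elim: K => [|K IHK]; first by apply: nearW.
have /cvgrPdist_lt/(_ _ d0) := lF K.+1%:R (ltr0Sn _ _).
apply: filterS2 IHK => s IHs hs k; rewrite ltnS leq_eqVlt => /predU1P[->|/IHs//].
by rewrite distrC.
Qed.

Theorem theorem1p1 (R : realType) (d : measure_display)
    (Omega : measurableType d) (P : probability Omega R)
    (T : R -> Omega -> R) (phi : R -> R) (gamma : R) :
  subordinator P T -> laplace_exponent P T phi ->
  0 <= gamma -> gamma < 2 ->
  let H := fun lam => phi lam - lam * derive1 phi lam in
  let tail := fun t r => fine (P [set w | r <= T t w]) in
  let main := fun t r => (Gamma (2 - gamma))^-1 * t * H r^-1 in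
  let err := fun t r => t * phi r^-1 ^+ 2 / H r^-1 in
  (regvar_zero H gamma -> asymp_infty tail main err) /\
  (regvar_infty H gamma -> asymp_zero tail main err).
Proof.
move=> subT lapT g0 g2 H tail main err.
split=> -[H0 rv] eps eps0; have [K [delta [delta0 key]]] :=
  tail_asymptotics subT lapT H0 g0 g2 eps0.
(* Regular variation at [0] is used at [r^-1], which lies in []0, e[] as soon as [r > e^-1]. *)
- have [e /= e0 he] := near_regvar K delta0 rv.
  exists e^-1, delta; split => // t r t0 r0 er herr.
  apply: key => //; apply: he => /=; last by rewrite invr_gt0.
  rewrite sub0r normrN gtr0_norm ?invr_gt0//.
  by rewrite -[ltRHS]invrK ltf_pV2// posrE invr_gt0.
- have [M [_ hM]] := near_regvar K delta0 rv.
  (* The threshold [M] may be nonpositive; [|M| + 1] is positive and exceeds it, and [r^-1] exceeds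
     [|M| + 1]. *)
  exists (`|M| + 1)^-1, delta.
  have M0 : 0 < `|M| + 1 by rewrite ltr_wpDl.
  split; first by rewrite invr_gt0.
  split => // t r t0 r0 rM herr.
  apply: key => //; apply: hM.
  rewrite (le_lt_trans (ler_norm M))// (@lt_trans _ _ (`|M| + 1)) ?ltrDl//.
  by rewrite -[ltLHS]invrK ltf_pV2// posrE ?invr_gt0.
Qed.
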